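(* Let $(E,\pi)$ be a Jordan Banach triple system, let $\mathcal U$ be an ultrafilter and $J:E^{**}\to E_{\mathcal U}$ an isometric embedding as provided by Heinrich's theorem (properties (a) and (b) in the context), and let $\pi^{\mathcal U}:E^{**}\times E^{**}\times E^{**}\to E^{**}$ be the corresponding ultrapower extension of $\pi$. Then the following statements hold: (i) For $m,n,p\in E^{**}$, if at least two of $m,n,p$ lie in $E$, then $\pi^{\mathcal U}(m,n,p)=\pi^i(m,n,p)$ for each $i=0,\ldots,5$. (ii) Given $a\in E$, $n\in E^{**}$ and a bounded net $(c_\gamma)$ in $E$ $w^*$-converging to $p\in E^{**}$, one has $w^*\text{-}\lim_\gamma \pi^{\mathcal U}(a,n,c_\gamma)=\pi^1(a,n,p)$. (iii) Given $n\in E^{**}$ and bounded nets $(a_\alpha)$ and $(c_\gamma)$ in $E$ $w^*$-converging to $m\in E^{**}$ and $p\in E^{**}$, respectively, one has $w^*\text{-}\lim_\alpha w^*\text{-}\lim_\gamma \pi^{\mathcal U}(a_\alpha,n,c_\gamma)=w^*\text{-}\lim_\alpha \pi^1(a_\alpha,n,p)=\pi^1(m,n,p)$. (iv) If $\pi^{\mathcal U}$ is $w^*$-continuous in the first (or, equivalently, third) variable, then $\pi^{\mathcal U}=\pi^1=\pi^4$.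
   Context: Jordan Banach triple systems are taken complex: a complex Banach space $E$ with a jointly continuous map $\pi=\{\cdot,\cdot,\cdot\}:E\times E\times E\to E$ which is bilinear and symmetric in the outer variables, conjugate linear in the middle one, and satisfies the Jordan identity $\{a,b,\{c,d,e\}\}=\{\{a,b,c\},d,e\}-\{c,\{b,a,d\},e\}+\{c,d,\{a,b,e\}\}$ for all $a,b,c,d,e\in E$. $E$ is identified with its canonical image in $E^{**}$. Aron--Berner extensions: the six extensions $\pi^0,\dots,\pi^5:E^{**}\times E^{**}\times E^{**}\to E^{**}$ of $\pi$ (bilinear in the outer variables, conjugate linear in the middle one) are given by iterated $w^*$-limits: for $m,n,p\in E^{**}$ and bounded nets $(m_{\alpha_1}),(n_{\alpha_2}),(p_{\alpha_3})$ in $E$ converging in the $w^*$-topology to $m,n,p$ respectively, $\pi^i(m,n,p)=w^*\text{-}\lim_{\alpha_{\sigma_i(1)}}\lim_{\alpha_{\sigma_i(2)}}\lim_{\alpha_{\sigma_i(3)}}\pi(m_{\alpha_1},n_{\alpha_2},p_{\alpha_3})$ (all limits in the $w^*$-topology, the rightmost limit taken first; the result does not depend on the nets), where $(\sigma_i(1),\sigma_i(2),\sigma_i(3))$ is $(1,2,3)$ for $i=0$, $(1,3,2)$ for $i=1$, $(3,2,1)$ for $i=2$, $(2,1,3)$ for $i=3$, $(3,1,2)$ for $i=4$, $(2,3,1)$ for $i=5$. Ultrapowers: for an ultrafilter $\mathcal U$ on a nonempty set $I$, $E_{\mathcal U}$ is the quotient of the Banach space of bounded families $(x_i)_{i\in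 I}$ in $E$ (sup norm) by the closed subspace of families with $\lim_{\mathcal U}\|x_i\|=0$; the class of $(x_i)$ is denoted $[x_i]_{\mathcal U}$. The canonical embedding of $E$ into $E_{\mathcal U}$ sends $x$ to the class of the constant family $x$. By a theorem of Heinrich, for each Banach space $E$ there are an ultrafilter $\mathcal U$ and a linear isometric embedding $J:E^{**}\to E_{\mathcal U}$ such that: (a) $J|_E$ is the canonical embedding of $E$ into $E_{\mathcal U}$; (b) if $a\in E^{**}$ and $J(a)=[a_i]_{\mathcal U}$ then $w^*\text{-}\lim_{\mathcal U}a_i=a$, and the map $[x_i]_{\mathcal U}\mapsto w^*\text{-}\lim_{\mathcal U}x_i\in E^{**}$ (with $E^{**}$ identified with $J(E^{**})$) is a contractive projection of $E_{\mathcal U}$ onto $J(E^{**})$. Such $\mathcal U$ and $J$ are fixed. Ultrapower extension: $\pi^{\mathcal U}(m,n,p)=w^*\text{-}\lim_{\mathcal U}\pi(a_i,b_i,c_i)$ for $m,n,p\in E^{**}$ with $J(m)=[a_i]_{\mathcal U}$, $J(n)=[b_i]_{\mathcal U}$, $J(p)=[c_i]_{\mathcal U}$. *)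

(* Defs.v *)
From HB Require Import structures.
From mathcomp Require Import all_boot all_order all_algebra.
From mathcomp Require Import all_classical all_reals all_analysis.
From mathcomp Require Import complex.
Set Implicit Arguments.
Unset Strict Implicit.
Unset Printing Implicit Defensive.
Import Order.TTheory GRing.Theory Num.Theory.
Import numFieldNormedType.Exports.
Local Open Scope ring_scope.
Local Open Scope classical_set_scope.
Local Open Scope complex_scope.
Local Open Scope quotient_scope.

(* Norms on a [normedModType R[i]] take their values in R[i]; suprema and
   infima live in R, so norms are built from their real parts. *)
Definition rnorm (R : realType) (V : normedModType R[i]) (x : V) : R :=
  complex.Re `|x|.

Section rnorm_theory.
Context {R : realType} {V : normedModType R[i]}.
Implicit Types x y : V.

Lemma rnormE x : (rnorm x)%:C = `|x|.
Proof. by rewrite /rnorm RRe_real// ger0_real. Qed.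

Lemma rnorm_ge0 x : 0 <= rnorm x.
Proof. by rewrite -ler0c rnormE. Qed.

Lemma rnormD x y : rnorm (x + y) <= rnorm x + rnorm y.
Proof. by rewrite -lecR rmorphD /= !rnormE ler_normD. Qed.

Lemma rnormZ (l : R[i]) x : rnorm (l *: x) = rnorm (l : R[i]^o) * rnorm x.
Proof. by apply: complexI; rewrite rmorphM /= !rnormE normrZ. Qed.

Lemma rnorm0 : rnorm (0 : V) = 0.
Proof. by apply: complexI; rewrite rnormE normr0. Qed.

Lemma rnorm0_eq0 x : rnorm x = 0 -> x = 0.
Proof. by move=> x0; apply/normr0_eq0; rewrite -rnormE x0. Qed.

Lemma rnorm_le x (M : R[i]) : `|x| <= M -> rnorm x <= complex.Re M.
Proof. by rewrite lecE => /andP[]. Qed.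
End rnorm_theory.

Lemma norm_homogeneous (R : realType) (V : lmodType R[i]) (N : V -> R) :
  (forall x, 0 <= N x) ->
  (forall l x, N (l *: x) <= rnorm (l : R[i]^o) * N x) ->
  forall l x, (N (l *: x))%:C = `|l| * (N x)%:C.
Proof.
move=> N0 NZ l x; rewrite -[`|l|](rnormE (l : R[i]^o)) -rmorphM; congr (_%:C).
apply/eqP; rewrite eq_le NZ /=.
have [->|l0] := eqVneq l 0; first by rewrite (@rnorm0 _ R[i]^o) mul0r.
have rl0 : 0 < rnorm (l : R[i]^o).
  rewrite lt_neqAle rnorm_ge0 andbT eq_sym; apply: contraNneq l0.
  by move=> /(@rnorm0_eq0 _ R[i]^o) ->.
have := NZ l^-1 (l *: x); rewrite scalerA mulVf// scale1r => /(ler_wpM2l (ltW rl0)).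
move/le_trans; apply; rewrite mulrA.
have -> : rnorm (l : R[i]^o) * rnorm (l^-1 : R[i]^o) = 1; last by rewrite mul1r.
by apply: complexI; rewrite rmorphM /= !rnormE normfV divff// normr_eq0.
Qed.

Section dual.
Context {R : realType} (V : normedModType R[i]).

Definition in_dual : {pred V -> R[i]^o} :=
  fun f => `[< linear f /\ continuous f >].

Lemma in_dualP (f : V -> R[i]^o) :
  reflect (linear f /\ continuous f) (f \in in_dual).
Proof. exact: asboolP. Qed.

Lemma in_dual_submod_closed : submod_closed in_dual.
Proof.
split.
  apply/in_dualP; split; last by move=> x; exact: cvg_cst.
  by move=> k x y; rewrite /= scaler0 addr0.
move=> k f g /in_dualP[lf cf] /in_dualP[lg cg]; apply/in_dualP; split.
  move=> a x y; change (k *: f (a *: x + y) + g (a *: x + y) =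
    a *: (k *: f x + g x) + (k *: f y + g y)).
  by rewrite lf lg !scalerDr !scalerA [k * a]mulrC addrACA.
move=> x; apply: (@cvgD _ _ _ _ _ (k \*: f) g); last exact: cg.
by apply: cvgZr; exact: cf.
Qed.

HB.instance Definition _ :=
  GRing.isSubmodClosed.Build _ _ in_dual in_dual_submod_closed.

Record dual := Dual { dual_fun :> V -> R[i]^o; dual_funP : dual_fun \in in_dual }.

HB.instance Definition _ := [isSub for dual_fun].
HB.instance Definition _ := [Choice of dual by <:].
HB.instance Definition _ := [SubChoice_isSubLmodule of dual by <:].

Lemma dual_linear (f : dual) : linear f.
Proof. by case/in_dualP: (dual_funP f). Qed.

Lemma dual_continuous (f : dual) : continuous f.
Proof. by case/in_dualP: (dual_funP f). Qed.

HB.instance Definition _ (f : dual) :=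
  GRing.isLinear.Build R[i] V R[i]^o _ f (dual_linear f).

Definition dual_norm (f : dual) : R :=
  sup [set rnorm (f x) | x in [set x : V | `|x| <= 1]].

Lemma dual_bounded (f : dual) :
  exists2 M : R, 0 <= M & forall x, rnorm (f x) <= M * rnorm x.
Proof.
have /linear_boundedP/pinfty_ex_gt0[M M0 fM] :=
  (linear_bounded_continuous f).2 (@dual_continuous f).
have ME : (complex.Re M)%:C = M by rewrite RRe_real// gtr0_real.
exists (complex.Re M); first by rewrite -ler0c ME ltW.
by move=> x; rewrite -lecR rmorphM /= ME !rnormE; exact: fM.
Qed.

Let dual_set (f : dual) := [set rnorm (f x) | x in [set x : V | `|x| <= 1]].

Let dual_set0 f : dual_set f !=set0.
Proof. by exists (rnorm (f 0)), 0; rewrite //= normr0. Qed.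

Let dual_set_ub f : has_sup (dual_set f).
Proof.
split; first exact: dual_set0.
have [M M0 fM] := dual_bounded f; exists M => _ [x /= x1 <-].
apply: (le_trans (fM x)); rewrite -[leRHS]mulr1 ler_wpM2l//.
exact: rnorm_le x1.
Qed.

Lemma dual_norm_ub (f : dual) x : `|x| <= 1 -> rnorm (f x) <= dual_norm f.
Proof. by move=> x1; apply: ub_le_sup; [case: (dual_set_ub f)|exists x]. Qed.

Lemma dual_norm_le (f : dual) M :
  (forall x, `|x| <= 1 -> rnorm (f x) <= M) -> dual_norm f <= M.
Proof.
by move=> fM; apply: ge_sup; [exact: dual_set0|move=> _ [x /= x1 <-]; exact: fM].
Qed.

Lemma dual_norm_ge0 f : 0 <= dual_norm f.
Proof.
by apply: le_trans (rnorm_ge0 (f 0)) (dual_norm_ub _ _); rewrite normr0.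
Qed.

Let norm (f : dual) : R[i] := (dual_norm f)%:C.

Let normD f g : norm (f + g) <= norm f + norm g.
Proof.
rewrite -rmorphD lecR; apply: dual_norm_le => x x1.
apply: (le_trans (rnormD _ _)).
by apply: lerD; exact: dual_norm_ub.
Qed.

Let normZ (l : R[i]) f : norm (l *: f) = `|l| * norm f.
Proof.
apply: norm_homogeneous => [|{}l {}f]; first exact: dual_norm_ge0.
apply: dual_norm_le => x x1; rewrite [X in rnorm X](_ : _ = l *: f x)//.
by rewrite rnormZ ler_wpM2l ?rnorm_ge0// dual_norm_ub.
Qed.

Let norm0_eq0 f : norm f = 0 -> f = 0.
Proof.
move=> /complexI f0; apply/val_inj/funext => x /=; rewrite /GRing.zero/=.
have f1 y : `|y| <= 1 -> f y = 0.
  move=> y1; apply: rnorm0_eq0; apply/eqP.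
  by rewrite eq_le rnorm_ge0 andbT -f0 dual_norm_ub.
have [->|x0] := eqVneq x 0; first exact: linear0.
have : f (`|x|^-1 *: x) = 0.
  by apply: f1; rewrite normrZ normfV normr_id mulVf// normr_eq0.
rewrite linearZ => /eqP; rewrite scaler_eq0 invr_eq0 normr_eq0 (negbTE x0).
by move=> /eqP.
Qed.

HB.instance Definition _ := Lmodule_isNormed.Build _ dual normD normZ norm0_eq0.

Lemma dual_normE (f : dual) : `|f| = (dual_norm f)%:C. Proof. by []. Qed.

End dual.

Lemma dual_norm_mul (R : realType) (V : normedModType R[i]) (f : dual V) x :
  `|f x| <= `|f| * `|x|.
Proof.
have [->|x0] := eqVneq x 0; first by rewrite linear0 !normr0 mulr0.
have xgt0 : 0 < `|x| by rewrite normr_gt0.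
rewrite -ler_pdivrMr// dual_normE mulrC.
have -> : `|x|^-1 * `|f x| = (rnorm (f (`|x|^-1 *: x)))%:C.
  by rewrite rnormE linearZ normrZ normfV normr_id.
rewrite lecR; apply: dual_norm_ub.
by rewrite normrZ normfV normr_id mulVf// gt_eqF.
Qed.

Notation bidual E := (dual (dual E)).

Section canonical_image.
Context {R : realType} {E : normedModType R[i]}.

Definition eval_at (x : E) (f : dual E) : R[i]^o := f x.

HB.instance Definition _ x :=
  GRing.isLinear.Build R[i] (dual E) R[i]^o _ (eval_at x)
    (fun k f g => erefl).

Lemma eval_atP x : eval_at x \in in_dual (V := dual E).
Proof.
apply/in_dualP; split; first exact: linearP.
apply/linear_bounded_continuous/linear_boundedP.
near=> M => f; rewrite (le_trans (dual_norm_mul _ _))// mulrC ler_wpM2r//.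
Unshelve. all: by end_near. Qed.

Definition can_bidual (x : E) : bidual E := Dual (eval_atP x).
End canonical_image.

(* The w*-topology of a dual: pointwise convergence on the predual. *)
Definition wstar (R : realType) (V : normedModType R[i]) :=
  initial_topology (fun f : dual V => (f : V -> R[i]^o) : {ptws V -> R[i]^o}).

HB.instance Definition _ (R : realType) (V : normedModType R[i]) :=
  Topological.on (wstar V).

Definition wstar_cvg (R : realType) (V : normedModType R[i]) (T : Type)
    (F : set_system T) (x : T -> dual V) (q : dual V) : Prop :=
  (fun t => x t : wstar V) @ F --> (q : wstar V).

Definition wstar_continuous (R : realType) (V W : normedModType R[i])
  (f : dual V -> dual W) : Prop := continuous (f : wstar V -> wstar W).

Lemma wstar_cvgP (R : realType) (V : normedModType R[i]) (T : Type)
    (F : set_system T) (x : T -> dual V) (q : dual V) : Filter F ->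
  wstar_cvg F x q <-> forall f : V, x t f @[t --> F] --> q f.
Proof.
move=> FF; pose g (f : dual V) : {ptws V -> R[i]^o} := (f : V -> R[i]^o).
have -> : wstar_cvg F x q <-> {ptws, (g \o x) @ F --> g q}.
  split=> [xq|xq B].
    exact: cvg_comp xq (@initial_continuous _ _ g q).
  rewrite nbhsE => -[A [[C oC CA] Aq] AB]; apply: filterS AB _.
  by rewrite -CA in Aq *; apply: xq; apply: open_nbhs_nbhs; split.
by rewrite pointwise_cvgP.
Qed.

Record directed := Directed {
  directed_sort :> Type;
  directed_le : directed_sort -> directed_sort -> Prop;
  directed_refl : forall a, directed_le a a;
  directed_trans : forall a b c,
    directed_le a b -> directed_le b c -> directed_le a c;
  directed_nonempty : inhabited directed_sort;
  directed_ub : forall a b, exists2 c, directed_le a c & directed_le b c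
}.

Definition tails (D : directed) : set_system D :=
  [set A | exists d, forall e, directed_le d e -> A e].

Instance tails_filter (D : directed) : ProperFilter (@tails D).
Proof.
split=> [[d dF]|]; first by apply: (dF d); exact: directed_refl.
split.
- by have [a] := directed_nonempty D; exists a.
- move=> A B [a aA] [b bB]; have [c ac bc] := directed_ub a b.
  exists c => e ce; split; [apply: aA|apply: bB].
    exact: directed_trans ac ce.
  exact: directed_trans bc ce.
- by move=> A B AB [a aA]; exists a => e /aA/AB.
Qed.

Definition bounded_family (R : realType) (V : normedModType R[i]) (T : Type)
  (x : T -> V) : Prop := exists M : R[i], forall t, `|x t| <= M.

Section bounded_families.
Context {R : realType} (I : Type) (E : normedModType R[i]).

Definition in_linfty : {pred I -> E} := fun x => `[< bounded_family x >].

Lemma in_linftyP (x : I -> E) : reflect (bounded_family x) (x \in in_linfty).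
Proof. exact: asboolP. Qed.

Lemma in_linfty_submod_closed : submod_closed in_linfty.
Proof.
split; first by apply/in_linftyP; exists 0 => t; rewrite normr0.
move=> k x y /in_linftyP[M xM] /in_linftyP[N yN].
apply/in_linftyP; exists (`|k| * M + N) => t.
rewrite (le_trans (ler_normD _ _))// lerD// normrZ ler_wpM2l//.
Qed.

HB.instance Definition _ :=
  GRing.isSubmodClosed.Build _ _ in_linfty in_linfty_submod_closed.

Record linfty := Linfty {
  linfty_fun :> I -> E; linfty_funP : linfty_fun \in in_linfty }.

HB.instance Definition _ := [isSub for linfty_fun].
HB.instance Definition _ := [Choice of linfty by <:].
HB.instance Definition _ := [SubChoice_isSubLmodule of linfty by <:].

Definition linfty_norm (x : linfty) : R := sup [set rnorm (x i) | i in setT].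

Let rset (x : linfty) := [set rnorm (x i) | i in setT].

Let rset_ub x : has_ubound (rset x).
Proof.
have /in_linftyP[M xM] := linfty_funP x.
by exists (complex.Re M) => _ [i _ <-]; apply: rnorm_le.
Qed.

Lemma linfty_norm_ub (x : linfty) i : rnorm (x i) <= linfty_norm x.
Proof. by apply: ub_le_sup; [exact: rset_ub|exists i]. Qed.

Lemma linfty_norm_ge0 x : 0 <= linfty_norm x.
Proof.
have [[_ [i _ _]]|/set0P/negP/negPn/eqP e] := pselect (rset x !=set0).
  exact: le_trans (rnorm_ge0 (x i)) (linfty_norm_ub x i).
by rewrite /linfty_norm -/(rset x) e sup0.
Qed.

Lemma linfty_norm_le (x : linfty) M :
  0 <= M -> (forall i, rnorm (x i) <= M) -> linfty_norm x <= M.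
Proof.
move=> M0 xM; have [ne|/set0P/negP/negPn/eqP e] := pselect (rset x !=set0).
  by apply: ge_sup => // _ [i _ <-].
by rewrite /linfty_norm -/(rset x) e sup0.
Qed.

Let norm (x : linfty) : R[i] := (linfty_norm x)%:C.

Let normD x y : norm (x + y) <= norm x + norm y.
Proof.
rewrite -rmorphD lecR; apply: linfty_norm_le => [|i].
  by rewrite addr_ge0 ?linfty_norm_ge0.
apply: (le_trans (rnormD _ _)).
by apply: lerD; exact: linfty_norm_ub.
Qed.

Let normZ (l : R[i]) x : norm (l *: x) = `|l| * norm x.
Proof.
apply: norm_homogeneous => [|{}l {}x]; first exact: linfty_norm_ge0.
apply: linfty_norm_le => [|i].
  by rewrite mulr_ge0 ?rnorm_ge0 ?linfty_norm_ge0.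
rewrite [X in rnorm X](_ : _ = l *: x i)//.
by rewrite rnormZ ler_wpM2l ?rnorm_ge0// linfty_norm_ub.
Qed.

Let norm0_eq0 x : norm x = 0 -> x = 0.
Proof.
move=> /complexI x0; apply/val_inj/funext => i; apply: rnorm0_eq0.
by apply/eqP; rewrite eq_le rnorm_ge0 andbT -x0 linfty_norm_ub.
Qed.

HB.instance Definition _ :=
  Lmodule_isNormed.Build _ linfty normD normZ norm0_eq0.

Lemma linfty_normE (x : linfty) : `|x| = (linfty_norm x)%:C. Proof. by []. Qed.

End bounded_families.

Lemma bounded_cst (R : realType) (I : Type) (E : normedModType R[i]) (x : E) :
  (fun=> x : E) \in in_linfty (I := I) (E := E).
Proof. by apply/in_linftyP; exists `|x|. Qed.

Record ultrafilter_on (I : Type) := UltrafilterOn {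
  ultrafilter_sets :> set_system I;
  ultrafilterP : UltraFilter ultrafilter_sets
}.

Instance ultrafilter_proper (I : Type) (U : ultrafilter_on I) :
  ProperFilter (U : set_system I).
Proof. by case: U => U []. Qed.

Section ultrapower.
Context {R : realType} {I : Type} (E : normedModType R[i]).
Variable U : ultrafilter_on I.

Definition unull : {pred linfty I E} :=
  fun x => `[< `|x i| @[i --> ultrafilter_sets U] --> (0 : R[i]^o) >].

Lemma unullP (x : linfty I E) : reflect (x i @[i --> ultrafilter_sets U] --> 0) (x \in unull).
Proof. apply: (equivP (asboolP _)); exact: norm_cvg0P. Qed.

Lemma unullZD k x y : x \in unull -> y \in unull -> k *: x + y \in unull.
Proof.
move=> /unullP x0 /unullP y0; apply/unullP.
rewrite [X in _ --> X](_ : _ = k *: 0 + 0); last by rewrite scaler0 addr0.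
apply: (@cvgD _ _ _ _ _ (k \*: (x : I -> E)) y) => //.
by apply: cvgZr.
Qed.

Lemma unull0 : 0 \in unull.
Proof. apply/unullP; exact: cvg_cst. Qed.

Lemma unull_zmod_closed : zmod_closed unull.
Proof.
split; first exact: unull0.
move=> x y x0 y0; rewrite addrC -scaleN1r; exact: unullZD.
Qed.

HB.instance Definition _ := GRing.isZmodClosed.Build _ unull unull_zmod_closed.

(* [Quotient.quot] only provides a Z-module; the scalar multiplication and the
   quotient norm are added below. *)
Definition ultrapower := Quotient.quot unull.

HB.instance Definition _ := GRing.Zmodule.on ultrapower.

Definition uclass (x : linfty I E) : ultrapower := \pi_(Quotient.quot unull) x.

HB.instance Definition _ := GRing.Additive.copy uclass \pi_(Quotient.quot unull).

Lemma uclass_eq x y : uclass x = uclass y <-> x - y \in unull.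
Proof.
rewrite Quotient.idealrBE; split=> [xy|/eqP//].
by apply/eqP.
Qed.

Definition urepr (q : ultrapower) : linfty I E := repr q.

Lemma ureprK q : uclass (urepr q) = q. Proof. exact: reprK. Qed.

Definition uscale (k : R[i]) (q : ultrapower) : ultrapower :=
  uclass (k *: urepr q).

Lemma uscaleE k x : uscale k (uclass x) = uclass (k *: x).
Proof.
apply/uclass_eq; rewrite -scalerBr -[_ *: _]addr0; apply: unullZD; last exact: unull0.
by apply/uclass_eq; rewrite ureprK.
Qed.

Let uscaleA a b q : uscale a (uscale b q) = uscale (a * b) q.
Proof. by rewrite -[q]ureprK !uscaleE scalerA. Qed.

Let uscale1 : left_id 1 uscale.
Proof. by move=> q; rewrite -[q]ureprK !uscaleE scale1r. Qed.

Let uscaleDr : right_distributive uscale +%R.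
Proof.
by move=> k p q; rewrite -[p]ureprK -[q]ureprK -raddfD !uscaleE -raddfD scalerDr.
Qed.

Let uscaleDl q : {morph uscale^~ q : a b / a + b}.
Proof.
by move=> a b; rewrite -[q]ureprK !uscaleE scalerDl raddfD.
Qed.

HB.instance Definition _ := GRing.Zmodule_isLmodule.Build R[i] ultrapower
  uscaleA uscale1 uscaleDr uscaleDl.

Let uclass_scalable : scalable uclass.
Proof. by move=> k x; rewrite -uscaleE. Qed.

HB.instance Definition _ := GRing.isScalable.Build R[i] (linfty I E) ultrapower
  _ uclass uclass_scalable.

Definition uquot_norm (q : ultrapower) : R :=
  inf [set linfty_norm x | x in [set x | uclass x = q]].

Let nset (q : ultrapower) := [set linfty_norm x | x in [set x | uclass x = q]].

Let nset0 q : nset q !=set0.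
Proof. by exists (linfty_norm (urepr q)), (urepr q) => //; exact: ureprK. Qed.

Lemma uquot_norm_lb x : uquot_norm (uclass x) <= linfty_norm x.
Proof.
apply: ge_inf; last by exists x.
by exists 0 => _ [y _ <-]; exact: linfty_norm_ge0.
Qed.

Lemma uquot_norm_ge q M :
  (forall x, uclass x = q -> M <= linfty_norm x) -> M <= uquot_norm q.
Proof.
by move=> qM; apply: lb_le_inf; [exact: nset0|move=> _ [x xq <-]; exact: qM].
Qed.

Lemma uquot_norm_ge0 q : 0 <= uquot_norm q.
Proof. by apply: uquot_norm_ge => x _; exact: linfty_norm_ge0. Qed.

Let norm (q : ultrapower) : R[i] := (uquot_norm q)%:C.

Let linfty_normD (x y : linfty I E) :
  linfty_norm (x + y) <= linfty_norm x + linfty_norm y.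
Proof. by rewrite -lecR rmorphD /= -!linfty_normE ler_normD. Qed.

Let linfty_normZ k (x : linfty I E) :
  linfty_norm (k *: x) = rnorm (k : R[i]^o) * linfty_norm x.
Proof. by apply: complexI; rewrite rmorphM /= -!linfty_normE rnormE normrZ. Qed.

Let normD p q : norm (p + q) <= norm p + norm q.
Proof.
rewrite -rmorphD lecR -lerBlDl; apply: uquot_norm_ge => y yq.
rewrite lerBlDl -lerBlDr; apply: uquot_norm_ge => x xp; rewrite lerBlDr.
apply: le_trans (linfty_normD x y).
by rewrite -xp -yq -raddfD uquot_norm_lb.
Qed.

Let normZ (l : R[i]) q : norm (l *: q) = `|l| * norm q.
Proof.
apply: norm_homogeneous => [|{}l {}q]; first exact: uquot_norm_ge0.
have [->|l0] := eqVneq l 0.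
  rewrite scale0r (@rnorm0 _ R[i]^o) mul0r -(raddf0 uclass).
  apply: (le_trans (uquot_norm_lb _)).
  by rewrite -lecR -linfty_normE normr0.
have rl0 : 0 < rnorm (l : R[i]^o).
  rewrite lt_neqAle rnorm_ge0 andbT eq_sym; apply: contraNneq l0.
  by move=> /(@rnorm0_eq0 _ R[i]^o) ->.
rewrite -ler_pdivrMl//; apply: uquot_norm_ge => x <-.
by rewrite ler_pdivrMl// -linfty_normZ -linearZ uquot_norm_lb.
Qed.

Let norm0_eq0 q : norm q = 0 -> q = 0.
Proof.
move=> /complexI; rewrite -[q]ureprK; set x := urepr q => x0.
rewrite -(raddf0 uclass); apply/uclass_eq; rewrite subr0.
apply/unullP/cvgr0Pnorm_le => e e0.
have [y yx ye] : exists2 y, uclass y = uclass x & linfty_norm y < complex.Re e / 2.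
  apply: contrapT => h.
  have : complex.Re e / 2 <= uquot_norm (uclass x).
    apply: uquot_norm_ge => y yx; rewrite leNgt; apply/negP => ye.
    by apply: h; exists y.
  rewrite x0 leNgt divr_gt0//.
  by move: e0; rewrite ltcE => /andP[].
have /unullP/cvgr0_norm_le /(_ (e / 2)) := (uclass_eq x y).1 (esym yx).
have e20 : 0 < e / 2 by rewrite divr_gt0.
move=> /(_ e20); apply: filterS => i xyi.
rewrite -[x i](subrK (y i)) (le_trans (ler_normD _ _))// [e]splitr lerD//.
rewrite -rnormE; have -> : e / 2 = (complex.Re e / 2)%:C.
  by rewrite rmorphM /= fmorphV/= rmorph_nat RRe_real ?gtr0_real.
by rewrite lecR (le_trans (linfty_norm_ub _ _))// ltW.
Qed.

HB.instance Definition _ :=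
  Lmodule_isNormed.Build _ ultrapower normD normZ norm0_eq0.

Lemma ultrapower_normE (q : ultrapower) : `|q| = (uquot_norm q)%:C.
Proof. by []. Qed.

End ultrapower.

Record jordan_triple (R : realType) (E : normedModType R[i])
    (pi : E -> E -> E -> E) : Prop := {
  triple_continuous : continuous (fun x : E * E * E => pi x.1.1 x.1.2 x.2);
  triple_linear1 : forall b c, linear (fun a => pi a b c);
  triple_linear3 : forall a b, linear (fun c => pi a b c);
  triple_conj_linear2 : forall a c (k : R[i]) b b',
    pi a (k *: b + b') c = k^* *: pi a b c + pi a b' c;
  triple_sym : forall a b c, pi a b c = pi c b a;
  triple_jordan : forall a b c d e,
    pi a b (pi c d e) =
      pi (pi a b c) d e - pi c (pi b a d) e + pi c d (pi a b e)
}.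

(* [q] is the w*-limit, along the tails of A, of the w*-limits along the tails
   of B, of the w*-limits along the tails of C, of the family [x]; all the
   inner limits exist. *)
Definition iter_wlim (R : realType) (V : normedModType R[i])
    (A B C : directed) (x : A -> B -> C -> dual V) (q : dual V) : Prop :=
  exists y : A -> B -> dual V, exists z : A -> dual V,
    [/\ forall a b, wstar_cvg (@tails C) (x a b) (y a b),
        forall a, wstar_cvg (@tails B) (y a) (z a) &
        wstar_cvg (@tails A) z q].

(* The order of the limits in the i-th extension, outermost variable first
   (every i >= 5 is read as 5). *)
Definition iter_wlim_order (R : realType) (V : normedModType R[i]) (i : nat)
    (D1 D2 D3 : directed) (x : D1 -> D2 -> D3 -> dual V) : dual V -> Prop :=
  match i with
  | 0 => iter_wlim (fun a b c => x a b c)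
  | 1 => iter_wlim (fun a c b => x a b c)
  | 2 => iter_wlim (fun c b a => x a b c)
  | 3 => iter_wlim (fun b a c => x a b c)
  | 4 => iter_wlim (fun c a b => x a b c)
  | _ => iter_wlim (fun b c a => x a b c)
  end.

Section extensions.
Context {R : realType} {E : normedModType R[i]}.
Variable pi : E -> E -> E -> E.

Definition bounded_wnet (D : directed) (x : D -> E) (m : bidual E) : Prop :=
  bounded_family x /\ wstar_cvg (@tails D) (fun d => can_bidual (x d)) m.

(* The point that is the iterated limit for every choice of bounded nets; it
   is unique since, by Goldstine, there are such nets. *)
Definition aron_berner (i : nat) (m n p : bidual E) : bidual E :=
  get [set q | forall (D1 D2 D3 : directed)
      (x1 : D1 -> E) (x2 : D2 -> E) (x3 : D3 -> E),
    bounded_wnet x1 m -> bounded_wnet x2 n -> bounded_wnet x3 p ->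
    iter_wlim_order i
      (fun d1 d2 d3 => can_bidual (pi (x1 d1) (x2 d2) (x3 d3))) q].

Context {I : Type} {U : ultrafilter_on I}.

(* The w*-limit along U, which does not depend on the representatives. *)
Definition ultrapower_ext (J : bidual E -> ultrapower E U)
    (m n p : bidual E) : bidual E :=
  get [set q | forall a b c : linfty I E,
    J m = uclass U a -> J n = uclass U b -> J p = uclass U c ->
    wstar_cvg U (fun i => can_bidual (pi (a i) (b i) (c i))) q].

End extensions.

Definition linfty_cst (R : realType) (I : Type) (E : normedModType R[i])
  (x : E) : linfty I E := Linfty (bounded_cst I x).

(* The last field is the contractive projection of the ultrapower onto the
   image of J given by [x_i] |-> w*-lim_U x_i, the bidual being identified with
   its image under J. *)
Record heinrich (R : realType) (E : normedModType R[i]) (I : Type)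
    (U : ultrafilter_on I) (J : bidual E -> ultrapower E U) : Prop := {
  heinrich_linear : linear J;
  heinrich_isometry : forall m, `|J m| = `|m|;
  heinrich_can : forall x : E, J (can_bidual x) = uclass U (linfty_cst I x);
  heinrich_lim : forall (m : bidual E) (a : linfty I E), J m = uclass U a ->
    wstar_cvg U (fun i => can_bidual (a i)) m;
  heinrich_proj : exists P : ultrapower E U -> ultrapower E U,
    [/\ forall x : linfty I E, exists2 q : bidual E,
          wstar_cvg U (fun i => can_bidual (x i)) q & P (uclass U x) = J q,
        linear P, P \o P = P, range P = range J &
        forall xi, `|P xi| <= `|xi| ]
}.

(* Main.v *)
Require Import Defs.
From HB Require Import structures.
From mathcomp Require Import all_boot all_order all_algebra.
From mathcomp Require Import all_classical all_reals all_analysis.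
From mathcomp Require Import complex.
From mathcomp Require Import ring.
Set Implicit Arguments.
Unset Strict Implicit.
Unset Printing Implicit Defensive.
Import Order.TTheory GRing.Theory Num.Theory.
Import numFieldNormedType.Exports.
Local Open Scope ring_scope.
Local Open Scope classical_set_scope.

(** Each iterated w*-limit defining an Aron-Berner extension can be evaluated
    one variable at a time by pure duality. If g is a bounded linear form on a
    space X and x_d in X tends w* to m in its bidual, then g (x_d) tends to
    m g; if g is conjugate linear, it tends to the conjugate of m applied to
    the conjugate of g. Call this number [extend s g m], the bit s telling
    whether g is conjugate linear. Given a bounded map t of three variables,
    linear or conjugate linear in each, applying [extend] to f \o t in the
    innermost variable, then in the middle one, then in the outermost one,
    yields a number that is linear and bounded in the functional f, that is,
    an element of the bidual ([iter_ext]). It is the iterated limit along any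
    nets tending to the three points ([iter_ext_wlim]); so limits exist without
    any compactness argument.
    The six extensions are this construction for the six orderings of the
    variables ([aron_bernerE]); that an iterated limit determines the
    extension needs a bounded net converging to each point of the bidual, and
    a representative of J m supplies one, read along the sets of the
    ultrafilter ([heinrich_net]).

    If two of the three arguments are in E, every nesting collapses to a
    single [extend] in the remaining variable, since [extend s g] agrees with
    g on E. The ultrapower extension is also given by this number: represent
    the two elements of E by constant families, and the third point by a
    family that tends to it along U. This is (i), in the form
    [ultrapower_ext_two_in_E].

    The extension of index 1 has the first variable outermost and the middle
    one innermost. Hence it is w*-continuous in the first variable, and also in
    the third one when the first is in E ([iter_ext_cvg1], [iter_ext_cvg2]);
    with (i) this gives (ii) and (iii). If the ultrapower extension is
    w*-continuous in an outer variable then, being symmetric, it is so in both,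
    and taking the two limits in (iii) shows that it is the extension of
    index 1 ([ultrapower_ext_eq1]). Symmetry of the triple product exchanges
    the extensions of index 1 and 4, whence (iv). *)

(** * Linear and conjugate linear maps *)

Section conjugation.
Context {R : realType}.

(** The bit s records the variance: true stands for conjugate linear. Having
    it as data lets one construction serve all orders of the variables. *)
Definition conj_if (s : bool) (z : R[i]) : R[i] := if s then z^* else z.

Lemma conj_ifK s : involutive (conj_if s).
Proof. by case: s => z //=; rewrite conjCK. Qed.

Lemma conj_if_linear s k (z w : R[i]^o) :
  conj_if s (k *: z + w) = conj_if s k *: (conj_if s z : R[i]^o) + conj_if s w.
Proof. by case: s => //=; rewrite rmorphD rmorphM. Qed.

Lemma norm_conj_if s z : `|conj_if s z| = `|z|.
Proof. by case: s => //=; rewrite norm_conjC. Qed.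

Lemma conj_if_cvg s (T : Type) (F : set_system T) (g : T -> R[i]^o) (l : R[i]^o) :
  Filter F -> g @ F --> l ->
  (fun t => conj_if s (g t) : R[i]^o) @ F --> (conj_if s l : R[i]^o).
Proof.
move=> FF gl; apply/cvgrPdist_lt => e e0; move/cvgrPdist_lt: gl => /(_ e e0).
apply: filterS => t; case: s => //=.
by rewrite -rmorphB norm_conjC.
Qed.

Definition semilinear s (X Y : lmodType R[i]) (f : X -> Y) : Prop :=
  forall k x y, f (k *: x + y) = conj_if s k *: f x + f y.

Lemma semilinear0 s (X Y : lmodType R[i]) (f : X -> Y) :
  semilinear s f -> f 0 = 0.
Proof.
move=> fl; have := fl 1 0 0; rewrite scaler0 addr0.
have -> : conj_if s 1 = 1 by case: s {fl} => //=; rewrite rmorph1.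
by rewrite scale1r => /eqP; rewrite -subr_eq0 opprD addrA subrr sub0r oppr_eq0 => /eqP.
Qed.

Lemma semilinearB s (X Y : lmodType R[i]) (f : X -> Y) x y :
  semilinear s f -> f (x - y) = f x - f y.
Proof.
move=> fl; rewrite addrC -scaleN1r fl addrC.
have -> : conj_if s (-1) = -1 by case: s {fl} => //=; rewrite rmorphN1.
by rewrite scaleN1r.
Qed.

Lemma semilinearZ s (X Y : lmodType R[i]) (f : X -> Y) k x :
  semilinear s f -> f (k *: x) = conj_if s k *: f x.
Proof.
by move=> fl; have := fl k x 0; rewrite (semilinear0 fl) !addr0.
Qed.

End conjugation.

(** * Bounded functionals and w*-limits *)

Section wstar_limits.
Context {R : realType} {V : normedModType R[i]}.

Lemma wstar_cvg_unique (T : Type) (F : set_system T) (x : T -> dual V) p q :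
  ProperFilter F -> wstar_cvg F x p -> wstar_cvg F x q -> p = q.
Proof.
move=> FF /wstar_cvgP xp /wstar_cvgP xq; apply/val_inj/funext => f.
exact: (cvg_unique (@norm_hausdorff _ R[i]^o) (xp f) (xq f)).
Qed.

Lemma in_dual_bounded (h : V -> R[i]^o) (K : R[i]) :
  0 <= K -> semilinear false h -> (forall x, `|h x| <= K * `|x|) ->
  h \in in_dual (V := V).
Proof.
move=> K0 hl hK.
pose hL : {linear V -> R[i]^o} :=
  HB.pack h (GRing.isLinear.Build R[i] V R[i]^o _ h hl).
apply/in_dualP; split; first exact: hl.
apply/(@linear_bounded_continuous _ _ _ hL)/linear_boundedP.
exists K; split; first exact: ger0_real.
by move=> r /ltW Kr x; rewrite (le_trans (hK x))// ler_wpM2r.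
Qed.

Lemma dual_norm_bound (h : dual V) (K : R[i]) :
  0 <= K -> (forall x, `|h x| <= K * `|x|) -> `|h| <= K.
Proof.
move=> K0 hK; have KE : (complex.Re K)%:C%C = K by rewrite RRe_real// ger0_real.
rewrite dual_normE -KE lecR; apply: dual_norm_le => x x1.
rewrite -lecR rnormE KE (le_trans (hK x))// -[leRHS]mulr1.
by rewrite ler_wpM2l.
Qed.
End wstar_limits.

(** * Extending a semilinear form to the bidual *)

Section extend.
Context {R : realType} {X : normedModType R[i]}.

Definition semiform s (g : X -> R[i]^o) : Prop :=
  semilinear s g /\ exists2 K : R[i], 0 <= K & forall x, `|g x| <= K * `|x|.

(** The hypothesis sits inside the existential so that [linearize] is a total
    function of g; outside semiforms its value is arbitrary. *)
Lemma ex_linearize s (g : X -> R[i]^o) :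
  exists h : dual X, semiform s g -> forall x, h x = conj_if s (g x).
Proof.
have [[gl [K K0 gK]]|ng] := pselect (semiform s g); last by exists 0.
have gd : (fun x => conj_if s (g x) : R[i]^o) \in in_dual (V := X).
  apply: (in_dual_bounded K0) => [k x y|x]; last by rewrite norm_conj_if.
  by rewrite gl conj_if_linear conj_ifK.
by exists (Dual gd).
Qed.

Definition linearize s (g : X -> R[i]^o) : dual X := sval (cid (ex_linearize s g)).

Lemma linearizeE s g x : semiform s g -> linearize s g x = conj_if s (g x).
Proof. by move=> gs; rewrite /linearize; case: cid => h /= /(_ gs). Qed.

(** Conjugating before and after applying m makes the value the w*-limit of g
    along nets tending to m, also for a conjugate linear g. *)
Definition extend s (g : X -> R[i]^o) (m : bidual X) : R[i]^o :=
  conj_if s (m (linearize s g)).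

Lemma extend_can s g x : semiform s g -> extend s g (can_bidual x) = g x.
Proof.
move=> gs.
by rewrite /extend -[can_bidual _ _]/(linearize s g x) linearizeE// conj_ifK.
Qed.

Lemma semiform_comb s g1 g2 k : semiform s g1 -> semiform s g2 ->
  semiform s (fun x => k *: g1 x + g2 x).
Proof.
move=> [l1 [K1 K10 b1]] [l2 [K2 K20 b2]]; split=> [a x y|].
  rewrite l1 l2 !scalerDr !scalerA [k * _]mulrC.
  by rewrite addrACA.
exists (`|k| * K1 + K2) => [|x]; first by rewrite addr_ge0// mulr_ge0.
rewrite mulrDl (le_trans (ler_normD _ _))// lerD// normrZ -mulrA.
by rewrite ler_wpM2l.
Qed.

Lemma extend_linear s g1 g2 k m : semiform s g1 -> semiform s g2 ->
  extend s (fun x => k *: g1 x + g2 x) m = k *: extend s g1 m + extend s g2 m.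
Proof.
move=> s1 s2; have s12 := semiform_comb k s1 s2.
rewrite /extend.
have -> : linearize s (fun x => k *: g1 x + g2 x) =
    conj_if s k *: linearize s g1 + linearize s g2.
  apply/val_inj/funext => x.
  transitivity (conj_if s k *: linearize s g1 x + linearize s g2 x); last by [].
  rewrite -[LHS]/(linearize s _ x).
  by rewrite !linearizeE// conj_if_linear.
by rewrite linearP conj_if_linear conj_ifK.
Qed.

Lemma extend_norm s g (K : R[i]) m : 0 <= K -> semilinear s g ->
  (forall x, `|g x| <= K * `|x|) -> `|extend s g m| <= K * `|m|.
Proof.
move=> K0 gl gK; have gs : semiform s g by split=> //; exists K.
rewrite norm_conj_if (le_trans (dual_norm_mul _ _))// mulrC ler_wpM2r//.
apply: dual_norm_bound => // x.
by rewrite -[X in `|X|]/(linearize s g x) linearizeE// norm_conj_if.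
Qed.

(** An element of the bidual is evaluated here at a fixed functional, so this
    is w*-convergence followed by the continuity of the conjugation; with [extend_can] it
    identifies [extend s g m] as the limit of g along nets in X tending to
    m. *)
Lemma extend_cvg s g (T : Type) (F : set_system T) (x : T -> bidual X) m :
  Filter F -> wstar_cvg F x m -> extend s g (x t) @[t --> F] --> extend s g m.
Proof. by move=> FF /wstar_cvgP xm; apply: conj_if_cvg; exact: xm. Qed.

(** Extending in one variable keeps the variance in another one, so that the
    construction can be iterated. With Y the dual of the target it also gives
    the linearity of the result as an element of the bidual. *)
Lemma extend_semilinear (Y : normedModType R[i]) s s' (h : Y -> X -> R[i]^o) m :
  (forall y, semiform s (h y)) -> (forall x, semilinear s' (h^~ x)) ->
  semilinear s' (fun y => extend s (h y) m).
Proof.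
move=> hX hY k y z.
have E : h (k *: y + z) = fun x => conj_if s' k *: h y x + h z x.
  by apply/funext => x; rewrite hY.
by rewrite E extend_linear.
Qed.
End extend.

(** * Iterated extension of a map of three variables *)

Record semitrilinear (R : realType) (s1 s2 s3 : bool)
    (X Y Z W : normedModType R[i]) (t : X -> Y -> Z -> W) : Prop := {
  semitrilinear1 : forall b c, semilinear s1 (fun a => t a b c);
  semitrilinear2 : forall a c, semilinear s2 (fun b => t a b c);
  semitrilinear3 : forall a b, semilinear s3 (fun c => t a b c);
  semitrilinear_bounded : exists2 K : R[i], 0 <= K &
    forall a b c, `|t a b c| <= K * `|a| * `|b| * `|c|
}.

Lemma semitrilinearC12 (R : realType) s1 s2 s3 (X Y Z W : normedModType R[i])
    (t : X -> Y -> Z -> W) :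
  semitrilinear s1 s2 s3 t -> semitrilinear s2 s1 s3 (fun b a c => t a b c).
Proof.
move=> [t1 t2 t3 [K K0 tK]]; split=> //.
by exists K => // b a c; rewrite -[K * _ * _]mulrA [`|b| * _]mulrC mulrA.
Qed.

Lemma semitrilinearC23 (R : realType) s1 s2 s3 (X Y Z W : normedModType R[i])
    (t : X -> Y -> Z -> W) :
  semitrilinear s1 s2 s3 t -> semitrilinear s1 s3 s2 (fun a c b => t a b c).
Proof.
move=> [t1 t2 t3 [K K0 tK]]; split=> //.
by exists K => // a c b; rewrite -[leRHS]mulrA [`|c| * _]mulrC mulrA.
Qed.

Section iterated_extension.
Context {R : realType} {X Y Z W : normedModType R[i]}.
Context (s1 s2 s3 : bool) (t : X -> Y -> Z -> W).
Context (ht : semitrilinear s1 s2 s3 t).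

Implicit Types (m : bidual X) (n : bidual Y) (p : bidual Z) (f : dual W).

(** The value at f of the extension after the innermost limit, over the third
    variable, has been taken; the next two definitions take the second and
    the first. *)
Definition iter_form3 p f a b : R[i]^o := extend s3 (fun c => f (t a b c)) p.

Definition iter_form2 n p f a : R[i]^o := extend s2 (iter_form3 p f a) n.

Definition iter_form1 m n p f : R[i]^o := extend s1 (iter_form2 n p f) m.

Let dual_semilinear s (V : normedModType R[i]) (g : V -> W) f :
  semilinear s g -> semilinear s (f \o g).
Proof. by move=> gl k x y; rewrite /= gl linearP. Qed.

Let iter_bound : exists2 K : R[i], 0 <= K & forall f a b c,
  `|f (t a b c)| <= K * `|f| * `|a| * `|b| * `|c|.
Proof.
have [_ _ _ [K K0 tK]] := ht; exists K => // f a b c.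
apply: (le_trans (dual_norm_mul _ _)); rewrite [K * _]mulrC -!mulrA.
by rewrite ler_wpM2l// !mulrA.
Qed.

Lemma iter_form_semi3 f a b : semiform s3 (fun c => f (t a b c)).
Proof.
split; first by apply: dual_semilinear; exact: (semitrilinear3 ht).
have [K K0 tK] := iter_bound; exists (K * `|f| * `|a| * `|b|) => //.
by rewrite !mulr_ge0.
Qed.

Let iter_form3_bound : exists2 K : R[i], 0 <= K & forall p f a b,
  `|iter_form3 p f a b| <= K * `|p| * `|f| * `|a| * `|b|.
Proof.
have [K K0 tK] := iter_bound; exists K => // p f a b.
have -> : K * `|p| * `|f| * `|a| * `|b| = K * `|f| * `|a| * `|b| * `|p|.
  by rewrite -!mulrA; congr (_ * _); rewrite mulrC -!mulrA.
apply: extend_norm => //; first by rewrite !mulr_ge0.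
by have [] := iter_form_semi3 f a b.
Qed.

Lemma iter_form_semi2 p f a : semiform s2 (iter_form3 p f a).
Proof.
split.
  apply: extend_semilinear => [b|c]; first exact: iter_form_semi3.
  by apply: dual_semilinear; exact: (semitrilinear2 ht).
have [K K0 tK] := iter_form3_bound; exists (K * `|p| * `|f| * `|a|) => //.
by rewrite !mulr_ge0.
Qed.

Let iter_form2_bound : exists2 K : R[i], 0 <= K & forall n p f a,
  `|iter_form2 n p f a| <= K * `|n| * `|p| * `|f| * `|a|.
Proof.
have [K K0 tK] := iter_form3_bound; exists K => // n p f a.
have -> : K * `|n| * `|p| * `|f| * `|a| = K * `|p| * `|f| * `|a| * `|n|.
  by rewrite -!mulrA; congr (_ * _); rewrite mulrC -!mulrA.
apply: extend_norm => //; first by rewrite !mulr_ge0.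
by have [] := iter_form_semi2 p f a.
Qed.

Lemma iter_form_semi1 n p f : semiform s1 (iter_form2 n p f).
Proof.
split.
  apply: extend_semilinear => [a|b]; first exact: iter_form_semi2.
  apply: extend_semilinear => [a|c]; first exact: iter_form_semi3.
  by apply: dual_semilinear; exact: (semitrilinear1 ht).
have [K K0 tK] := iter_form2_bound; exists (K * `|n| * `|p| * `|f|) => //.
by rewrite !mulr_ge0.
Qed.

(** All three partial forms satisfy a bound with one constant K, the norms of
    the points of the biduals entering as factors; the last bound makes the
    value continuous in f. *)
Lemma ex_iter_ext m n p : exists q : bidual W, forall f, q f = iter_form1 m n p f.
Proof.
have [K K0 tK] := iter_form2_bound.
have qd : iter_form1 m n p \in in_dual (V := dual W).
  apply: (@in_dual_bounded _ _ _ (K * `|m| * `|n| * `|p|)).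
  - by rewrite !mulr_ge0.
  - apply: extend_semilinear => [f|a]; first exact: iter_form_semi1.
    apply: extend_semilinear => [f|b]; first exact: iter_form_semi2.
    by apply: extend_semilinear => [f|c]; first exact: iter_form_semi3.
  - move=> f; have -> : K * `|m| * `|n| * `|p| * `|f| =
        K * `|n| * `|p| * `|f| * `|m|.
      by rewrite -!mulrA; congr (_ * _); rewrite mulrC -!mulrA.
    apply: extend_norm => //; first by rewrite !mulr_ge0.
    by have [] := iter_form_semi1 n p f.
by exists (Dual qd).
Qed.

Definition iter_ext m n p : bidual W := sval (cid (ex_iter_ext m n p)).

Lemma iter_extE m n p f : iter_ext m n p f = iter_form1 m n p f.
Proof. by rewrite /iter_ext; case: cid. Qed.

Lemma iter_ext_can1 a n p f :
  iter_ext (can_bidual a) n p f = iter_form2 n p f a.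
Proof. by rewrite iter_extE /iter_form1 extend_can//; exact: iter_form_semi1. Qed.

Lemma iter_form3_can f a b c :
  iter_form3 (can_bidual c) f a b = f (t a b c).
Proof. by rewrite /iter_form3 extend_can//; exact: iter_form_semi3. Qed.

Lemma iter_form2_can p f a b :
  iter_form2 (can_bidual b) p f a = iter_form3 p f a b.
Proof. by rewrite /iter_form2 extend_can//; exact: iter_form_semi2. Qed.

Lemma iter_ext_can12 a b p f : iter_ext (can_bidual a) (can_bidual b) p f =
  extend s3 (fun c => f (t a b c)) p.
Proof. by rewrite iter_ext_can1 iter_form2_can. Qed.

Lemma iter_ext_can13 a n c f : iter_ext (can_bidual a) n (can_bidual c) f =
  extend s2 (fun b => f (t a b c)) n.
Proof.
rewrite iter_ext_can1; congr (extend _ _ n); apply/funext => b.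
exact: iter_form3_can.
Qed.

Lemma iter_ext_can23 m b c f : iter_ext m (can_bidual b) (can_bidual c) f =
  extend s1 (fun a => f (t a b c)) m.
Proof.
rewrite iter_extE; congr (extend _ _ m); apply/funext => a.
by rewrite iter_form2_can iter_form3_can.
Qed.

(** Continuity in the outermost variable is unconditional; in a further
    variable it requires the variables outside it to be in the original
    space. *)
Lemma iter_ext_cvg1 (T : Type) (F : set_system T) (x : T -> bidual X) m n p :
  Filter F -> wstar_cvg F x m ->
  wstar_cvg F (fun d => iter_ext (x d) n p) (iter_ext m n p).
Proof.
move=> FF xm; apply/wstar_cvgP => f; rewrite iter_extE.
under eq_fun do rewrite iter_extE.
exact: extend_cvg xm.
Qed.

Lemma iter_ext_cvg2 (T : Type) (F : set_system T) (y : T -> bidual Y) a n p :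
  Filter F -> wstar_cvg F y n ->
  wstar_cvg F (fun d => iter_ext (can_bidual a) (y d) p)
    (iter_ext (can_bidual a) n p).
Proof.
move=> FF yn; apply/wstar_cvgP => f; rewrite iter_ext_can1.
under eq_fun do rewrite iter_ext_can1.
exact: extend_cvg yn.
Qed.

Lemma iter_ext_cvg3 (T : Type) (F : set_system T) (z : T -> Z) a b p :
  Filter F -> wstar_cvg F (fun d => can_bidual (z d)) p ->
  wstar_cvg F (fun d => can_bidual (t a b (z d)))
    (iter_ext (can_bidual a) (can_bidual b) p).
Proof.
move=> FF zp; apply/wstar_cvgP => f; rewrite iter_ext_can12.
rewrite [X in X @ _](_ : _ =
    (fun d => extend s3 (fun c => f (t a b c)) (can_bidual (z d)))).
  exact: extend_cvg zp.
by apply/funext => d; rewrite extend_can//; exact: iter_form_semi3.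
Qed.

(** The intermediate limits are the values of the same extension with the
    variables whose limit is still to be taken kept in the original
    spaces. *)
Lemma iter_ext_wlim (A B C : directed) (x : A -> X) (y : B -> Y) (z : C -> Z)
    m n p :
  wstar_cvg (@tails A) (fun d => can_bidual (x d)) m ->
  wstar_cvg (@tails B) (fun d => can_bidual (y d)) n ->
  wstar_cvg (@tails C) (fun d => can_bidual (z d)) p ->
  iter_wlim (fun a b c => can_bidual (t (x a) (y b) (z c))) (iter_ext m n p).
Proof.
move=> xm yn zp.
exists (fun a b => iter_ext (can_bidual (x a)) (can_bidual (y b)) p).
exists (fun a => iter_ext (can_bidual (x a)) n p); split=> [a b|a|].
- exact: iter_ext_cvg3.
- exact: iter_ext_cvg2.
- exact: iter_ext_cvg1.
Qed.

End iterated_extension.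

Lemma iter_wlim_unique (R : realType) (V : normedModType R[i])
    (A B C : directed) (x : A -> B -> C -> dual V) q q' :
  iter_wlim x q -> iter_wlim x q' -> q = q'.
Proof.
move=> [y [z [xy yz zq]]] [y' [z' [xy' yz' zq']]].
have yy : y = y'.
  by apply/funext => a; apply/funext => b; exact: wstar_cvg_unique (xy a b) (xy' a b).
have zz : z = z'.
  apply/funext => a; apply: wstar_cvg_unique (yz a) _; rewrite yy; exact: yz'.
by apply: wstar_cvg_unique zq _; rewrite zz.
Qed.

(** Continuity at the origin bounds t by 1 on small balls; rescaling each
    argument into such a ball gives a bound everywhere. *)
Lemma continuous_semitrilinear (R : realType) s1 s2 s3
    (X Y Z W : normedModType R[i]) (t : X -> Y -> Z -> W) :
  continuous (fun x : X * Y * Z => t x.1.1 x.1.2 x.2) ->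
  (forall b c, semilinear s1 (fun a => t a b c)) ->
  (forall a c, semilinear s2 (fun b => t a b c)) ->
  (forall a b, semilinear s3 (fun c => t a b c)) ->
  semitrilinear s1 s2 s3 t.
Proof.
move=> ct t1 t2 t3; split=> //.
have t0 b c : t 0 b c = 0 by exact: semilinear0 (t1 b c).
have t0' a c : t a 0 c = 0 by exact: semilinear0 (t2 a c).
have t0'' a b : t a b 0 = 0 by exact: semilinear0 (t3 a b).
have [r r0 rt] : exists2 r : R[i], 0 < r & forall a b c,
    `|a| < r -> `|b| < r -> `|c| < r -> `|t a b c| <= 1.
  have /cvgrPdist_le /(_ 1 ltr01) := ct (0, 0, 0).
  move=> /nbhs_ballP[r /= r0 rt]; exists r => // a b c ar br cr.
  have /rt /= : ball (0 : X, 0 : Y, 0 : Z) r (a, b, c).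
    by do 2?split; rewrite /= -ball_normE /ball_/= sub0r normrN.
  by rewrite t0 sub0r normrN.
have r2 : 0 < r / 2 by rewrite divr_gt0.
(* Each argument is scaled to norm r / 2, hence the third power. *)
exists ((r / 2) ^- 3) => [|a b c]; first by rewrite invr_ge0 exprn_ge0// ltW.
have [->|a0] := eqVneq a 0; first by rewrite t0 !normr0 mulr0 !mul0r.
have [->|b0] := eqVneq b 0; first by rewrite t0' !normr0 mulr0 !mul0r.
have [->|c0] := eqVneq c 0; first by rewrite t0'' !normr0 mulr0.
have scale (V : normedModType R[i]) (v : V) : v != 0 ->
    `|(r / 2 / `|v|) *: v| < r.
  move=> v0; rewrite normrZ normrM normfV normr_id divfK ?normr_eq0//.
  rewrite gtr0_norm// ltr_pdivrMr// mulr_natr mulr2n ltrDl//.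
have := rt _ _ _ (scale _ a a0) (scale _ b b0) (scale _ c c0).
rewrite (semilinearZ _ _ (t1 _ _)) (semilinearZ _ _ (t2 _ _)).
rewrite (semilinearZ _ _ (t3 _ _)) !normrZ !norm_conj_if.
have nE (V : normedModType R[i]) (v : V) : `|r / 2 / `|v| | = r / 2 / `|v|.
  by rewrite ger0_norm// mulr_ge0 ?invr_ge0// ltW.
rewrite !nE.
set u := r / 2 in r2 *.
set a1 := `|a|; set b1 := `|b|; set c1 := `|c| => h.
have a1_0 : 0 < a1 by rewrite normr_gt0.
have b1_0 : 0 < b1 by rewrite normr_gt0.
have c1_0 : 0 < c1 by rewrite normr_gt0.
have -> : `|t a b c| = u / a1 * (u / b1 * (u / c1 * `|t a b c|)) *
    (u ^- 3 * a1 * b1 * c1).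
  by field; rewrite !gt_eqF.
rewrite -[leRHS]mul1r ler_wpM2r// !mulr_ge0// ?invr_ge0 ?exprn_ge0//; exact: ltW.
Qed.

Lemma triple_semitrilinear (R : realType) (E : normedModType R[i])
    (pi : E -> E -> E -> E) :
  jordan_triple pi -> semitrilinear false true false pi.
Proof.
move=> [cpi pi1 pi3 pi2 _ _].
apply: (continuous_semitrilinear cpi) => [b c|a c|a b] k x y.
- exact: pi1.
- exact: pi2.
- exact: pi3.
Qed.

(** * An ultrafilter as a net *)

Section ultrafilter_net.
Context {I : Type} (U : ultrafilter_on I).

Let index := {A : set I | ultrafilter_sets U A}.
Let le (A B : index) := sval B `<=` sval A.

Let index_ub A B : exists2 C, le A C & le B C.
Proof.
case: A B => [A UA] [B UB].
by exists (exist _ (A `&` B) (filterI UA UB)) => ? [].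
Qed.

Let index_setT : index := exist _ setT (@filterT _ _ (ultrafilter_proper U)).

Let index_ex (A : index) : exists i, sval A i.
Proof. by case: A => A UA; exact: (@filter_ex _ _ (ultrafilter_proper U) _ UA). Qed.

(** Members of U, ordered by reverse inclusion: any choice of a point in each
    of them is a net that tends to U. *)
Definition ultrafilter_directed : directed :=
  @Directed index le (fun A => @subset_refl _ _)
    (fun A B C AB BC => subset_trans BC AB) (inhabits index_setT)
    index_ub.

Definition ultrafilter_point (A : ultrafilter_directed) : I :=
  sval (cid (index_ex A)).

Lemma ultrafilter_point_cvg :
  ultrafilter_point @ @tails ultrafilter_directed --> ultrafilter_sets U.
Proof.
move=> A UA; exists (exist _ A UA) => -[B UB] /= BA.
apply: BA; rewrite /ultrafilter_point; by case: cid.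
Qed.

Lemma ultrafilter_net (R : realType) (V : normedModType R[i])
    (x : I -> dual V) q : wstar_cvg U x q ->
  wstar_cvg (@tails ultrafilter_directed) (x \o ultrafilter_point) q.
Proof. by move=> xq; exact: (cvg_comp _ _ ultrafilter_point_cvg xq). Qed.
End ultrafilter_net.


(** * The six Aron-Berner extensions *)

Section six_extensions.
Context {R : realType} {E : normedModType R[i]}.
Context (pi : E -> E -> E -> E).
Context (hpi : semitrilinear false true false pi).

(** The arguments come in the order of the limits, outermost first; the proofs
    carry the variances through the same permutation. *)
Definition triple_ext (i : nat) (m n p : bidual E) : bidual E :=
  match i with
  | 0 => iter_ext hpi m n p
  | 1 => iter_ext (semitrilinearC23 hpi) m p n
  | 2 => iter_ext
      (semitrilinearC12 (semitrilinearC23 (semitrilinearC12 hpi))) p n m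
  | 3 => iter_ext (semitrilinearC12 hpi) n m p
  | 4 => iter_ext (semitrilinearC12 (semitrilinearC23 hpi)) p m n
  | _ => iter_ext (semitrilinearC23 (semitrilinearC12 hpi)) n p m
  end.

Lemma triple_ext_wlim i m n p (D1 D2 D3 : directed)
    (x1 : D1 -> E) (x2 : D2 -> E) (x3 : D3 -> E) :
  bounded_wnet x1 m -> bounded_wnet x2 n -> bounded_wnet x3 p ->
  iter_wlim_order i (fun d1 d2 d3 => can_bidual (pi (x1 d1) (x2 d2) (x3 d3)))
    (triple_ext i m n p).
Proof.
move=> [_ x1m] [_ x2n] [_ x3p].
case: i => [|[|[|[|[|i]]]]] /=.
- exact: (iter_ext_wlim hpi).
- exact: (iter_ext_wlim (semitrilinearC23 hpi)).
- exact: (iter_ext_wlim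
    (semitrilinearC12 (semitrilinearC23 (semitrilinearC12 hpi)))).
- exact: (iter_ext_wlim (semitrilinearC12 hpi)).
- exact: (iter_ext_wlim (semitrilinearC12 (semitrilinearC23 hpi))).
- exact: (iter_ext_wlim (semitrilinearC23 (semitrilinearC12 hpi))).
Qed.

Lemma iter_wlim_order_unique i (D1 D2 D3 : directed)
    (x : D1 -> D2 -> D3 -> bidual E) q q' :
  iter_wlim_order i x q -> iter_wlim_order i x q' -> q = q'.
Proof.
by case: i => [|[|[|[|[|i]]]]]; exact: iter_wlim_unique.
Qed.

(** Without convergent bounded nets the property defining [aron_berner] would
    hold for every point of the bidual; with them only the iterated limit has
    it. *)
Lemma aron_bernerE :
  (forall m : bidual E, exists D (x : directed_sort D -> E), bounded_wnet x m) ->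
  aron_berner pi = triple_ext.
Proof.
move=> nets; apply/funext => i; apply/funext => m; apply/funext => n.
apply/funext => p.
have [D1 [x1 x1m]] := nets m; have [D2 [x2 x2n]] := nets n.
have [D3 [x3 x3p]] := nets p.
have ex : exists q, [set q | forall (D1 D2 D3 : directed)
      (x1 : D1 -> E) (x2 : D2 -> E) (x3 : D3 -> E),
    bounded_wnet x1 m -> bounded_wnet x2 n -> bounded_wnet x3 p ->
    iter_wlim_order i
      (fun d1 d2 d3 => can_bidual (pi (x1 d1) (x2 d2) (x3 d3))) q] q.
  by exists (triple_ext i m n p) => *; exact: triple_ext_wlim.
have /(_ _ _ _ _ _ _ x1m x2n x3p) ab := getPex ex.
apply: iter_wlim_order_unique ab _; exact: triple_ext_wlim.
Qed.

(** When two arguments are in E, two of the three nested extensions are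
    evaluations, whatever the order: this and the next two lemmas are the
    reason why the six extensions agree there. *)
Lemma triple_ext_can12 i a b p f :
  triple_ext i (can_bidual a) (can_bidual b) p f =
    extend false (fun c => f (pi a b c)) p.
Proof.
case: i => [|[|[|[|[|i]]]]] /=.
- exact: iter_ext_can12.
- exact: iter_ext_can13.
- exact: iter_ext_can23.
- exact: iter_ext_can12.
- exact: iter_ext_can23.
- exact: iter_ext_can13.
Qed.

Lemma triple_ext_can13 i a n c f :
  triple_ext i (can_bidual a) n (can_bidual c) f =
    extend true (fun b => f (pi a b c)) n.
Proof.
case: i => [|[|[|[|[|i]]]]] /=.
- exact: iter_ext_can13.
- exact: iter_ext_can12.
- exact: iter_ext_can13.
- exact: iter_ext_can23.
- exact: iter_ext_can12.
- exact: iter_ext_can23.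
Qed.

Lemma triple_ext_can23 i m b c f :
  triple_ext i m (can_bidual b) (can_bidual c) f =
    extend false (fun a => f (pi a b c)) m.
Proof.
case: i => [|[|[|[|[|i]]]]] /=.
- exact: iter_ext_can23.
- exact: iter_ext_can23.
- exact: iter_ext_can12.
- exact: iter_ext_can13.
- exact: iter_ext_can13.
- exact: iter_ext_can12.
Qed.

End six_extensions.

(** * The ultrapower extension *)

Section ultrapower_extension.
Context {R : realType} {E : normedModType R[i]}.
Context (pi : E -> E -> E -> E).
Context (hpi : semitrilinear false true false pi).
Context {I : Type} {U : ultrafilter_on I} (J : bidual E -> ultrapower E U).
Context (hJ : heinrich J).

Lemma heinrich_net m : exists D (x : directed_sort D -> E), bounded_wnet x m.
Proof.
have JE := esym (ureprK (J m)); set a := urepr (J m) in JE.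
exists (ultrafilter_directed U), (a \o @ultrafilter_point _ U); split.
  by have /in_linftyP[M aM] := linfty_funP a; exists M => t; exact: aM.
exact: ultrafilter_net (heinrich_lim hJ JE).
Qed.

(** Changing the representatives one at a time makes the difference a sum of
    three terms, each with a factor that tends to 0 along U. *)
Lemma semitrilinear_ultraclass_cvg0 (a b c a' b' c' : linfty I E) :
  uclass U a = uclass U a' -> uclass U b = uclass U b' ->
  uclass U c = uclass U c' ->
  (pi (a i) (b i) (c i) - pi (a' i) (b' i) (c' i)) @[i --> ultrafilter_sets U]
    --> (0 : E).
Proof.
move=> /uclass_eq/unullP/norm_cvg0P aa /uclass_eq/unullP/norm_cvg0P bb.
move=> /uclass_eq/unullP/norm_cvg0P cc.
have [pi1 pi2 pi3 [K K0 piK]] := hpi.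
have bd (x : linfty I E) i : `|x i| <= `|x|.
  by rewrite -rnormE linfty_normE lecR linfty_norm_ub.
pose M := K * (`|b| * `|c| + `|a'| * `|c| + `|a'| * `|b'|).
pose d i := `|a i - a' i| + `|b i - b' i| + `|c i - c' i|.
have M0 : 0 <= M by rewrite mulr_ge0// !addr_ge0 ?mulr_ge0.
have dM0 : (d i * M : R[i]^o) @[i --> ultrafilter_sets U] --> (0 : R[i]^o).
  have -> : (0 : R[i]^o) = M *: ((0 + 0) + 0) by rewrite !addr0 scaler0.
  rewrite (_ : (fun i => _) = (fun i => M *: (d i : R[i]^o))); last first.
    by apply/funext => i; rewrite mulrC.
  apply: cvgZr; exact: cvgD (cvgD aa bb) cc.
have le i : `|pi (a i) (b i) (c i) - pi (a' i) (b' i) (c' i)| <= d i * M.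
  rewrite (_ : _ - _ = pi (a i - a' i) (b i) (c i) +
      pi (a' i) (b i - b' i) (c i) + pi (a' i) (b' i) (c i - c' i)); last first.
    rewrite (semilinearB _ _ (pi1 _ _)) (semilinearB _ _ (pi2 _ _)).
    by rewrite (semilinearB _ _ (pi3 _ _)) !addrA !subrK.
  rewrite (le_trans (ler_normD _ _))// !mulrDl lerD//.
    rewrite (le_trans (ler_normD _ _))// lerD//.
      rewrite (le_trans (piK _ _ _))// [K * _]mulrC -!mulrA ler_wpM2l//.
      rewrite ler_wpM2l// (le_trans (ler_pM _ _ (bd b i) (bd c i)))//.
      by rewrite -addrA lerDl addr_ge0 ?mulr_ge0.
    rewrite (le_trans (piK _ _ _))// [_ * `|b i - _|]mulrC -!mulrA ler_wpM2l//.
    rewrite ler_wpM2l// (le_trans (ler_pM _ _ (bd a' i) (bd c i)))//.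
    by rewrite addrAC lerDr addr_ge0 ?mulr_ge0.
  rewrite (le_trans (piK _ _ _))// mulrC ler_wpM2l// -mulrA ler_wpM2l//.
  rewrite (le_trans (ler_pM _ _ (bd a' i) (bd b' i)))//.
  by rewrite lerDr addr_ge0 ?mulr_ge0.
apply/cvgrPdist_lt => e e0.
move/cvgrPdist_lt: dM0 => /(_ e e0); apply: filterS => i.
rewrite !sub0r !normrN ger0_norm; last first.
  by rewrite mulr_ge0// !addr_ge0.
exact: le_lt_trans.
Qed.

(** The projection of the ultrapower onto the image of J provides the w*-limit
    for one choice of representatives. For any other choice the products
    differ by a family that tends to 0 in norm. *)
Lemma ultrapower_ext_lim m n p (a b c : linfty I E) :
  J m = uclass U a -> J n = uclass U b -> J p = uclass U c ->
  wstar_cvg U (fun i => can_bidual (pi (a i) (b i) (c i)))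
    (ultrapower_ext pi J m n p).
Proof.
have ex : exists q, [set q | forall a b c : linfty I E,
    J m = uclass U a -> J n = uclass U b -> J p = uclass U c ->
    wstar_cvg U (fun i => can_bidual (pi (a i) (b i) (c i))) q] q.
  pose a0 := urepr (J m); pose b0 := urepr (J n); pose c0 := urepr (J p).
  have pi0_bounded : (fun i => pi (a0 i) (b0 i) (c0 i)) \in in_linfty (I := I) (E := E).
    have [_ _ _ [K K0 piK]] := hpi.
    have bd (x : linfty I E) i : `|x i| <= `|x|.
      by rewrite -rnormE linfty_normE lecR linfty_norm_ub.
    apply/in_linftyP; exists (K * `|a0| * `|b0| * `|c0|) => i.
    rewrite (le_trans (piK _ _ _))//.
    by do 2?[apply: ler_pM; rewrite ?mulr_ge0//]; rewrite ler_wpM2l.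
  have [P [/(_ (Linfty pi0_bounded))[q /wstar_cvgP pi0q _] _ _ _ _]] :=
    heinrich_proj hJ.
  exists q => {}a {}b {}c; rewrite -[J m]ureprK -[J n]ureprK -[J p]ureprK.
  move=> /esym aa /esym bb /esym cc; apply/wstar_cvgP => f.
  have d0 := semitrilinear_ultraclass_cvg0 aa bb cc.
  have fd0 : f (pi (a i) (b i) (c i) - pi (a0 i) (b0 i) (c0 i))
      @[i --> ultrafilter_sets U] --> (0 : R[i]^o).
    by rewrite -(linear0 f); apply: cvg_comp d0 _; exact: dual_continuous.
  rewrite [X in _ --> X](_ : _ = 0 + q f); last by rewrite add0r.
  rewrite [X in X @ _](_ : _ = (fun i =>
      f (pi (a i) (b i) (c i) - pi (a0 i) (b0 i) (c0 i)) +
      f (pi (a0 i) (b0 i) (c0 i)))).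
    by apply: cvgD fd0 _; exact: pi0q.
  by apply/funext => i; rewrite -linearD subrK.
move=> Ja Jb Jc; exact: (getPex ex) Ja Jb Jc.
Qed.

Lemma ultrapower_ext_unique m n p (a b c : linfty I E) q :
  J m = uclass U a -> J n = uclass U b -> J p = uclass U c ->
  wstar_cvg U (fun i => can_bidual (pi (a i) (b i) (c i))) q ->
  ultrapower_ext pi J m n p = q.
Proof.
move=> Ja Jb Jc; exact: wstar_cvg_unique (ultrapower_ext_lim Ja Jb Jc).
Qed.

Lemma extend_ultraclass_cvg s g m (a : linfty I E) : semiform s g -> J m = uclass U a ->
  g (a i) @[i --> ultrafilter_sets U] --> extend s g m.
Proof.
move=> gs Ja; have am := heinrich_lim hJ Ja.
rewrite [X in X @ _](_ : _ = (fun i => extend s g (can_bidual (a i)))).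
  exact: extend_cvg am.
by apply/funext => i; rewrite extend_can.
Qed.

(** The elements of E are represented by constant families, so the limit along
    U involves one variable only and is the value found in [triple_ext_can12]
    and its variants. *)
Lemma ultrapower_ext_two_in_E m n p :
  (range can_bidual m /\ range can_bidual n) \/
  (range can_bidual m /\ range can_bidual p) \/
  (range can_bidual n /\ range can_bidual p) ->
  forall i, ultrapower_ext pi J m n p = triple_ext hpi i m n p.
Proof.
move=> + i; move=> [[[a _ <-] [b _ <-]]|[[[a _ <-] [c _ <-]]|[[b _ <-] [c _ <-]]]].
- apply: (ultrapower_ext_unique (heinrich_can hJ a) (heinrich_can hJ b)
    (esym (ureprK (J p)))).
  apply/wstar_cvgP => f; rewrite triple_ext_can12.
  by apply: extend_ultraclass_cvg (esym (ureprK _)); exact: (iter_form_semi3 hpi).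
- apply: (ultrapower_ext_unique (heinrich_can hJ a) (esym (ureprK (J n)))
    (heinrich_can hJ c)).
  apply/wstar_cvgP => f; rewrite triple_ext_can13.
  apply: extend_ultraclass_cvg (esym (ureprK _)).
  exact: (iter_form_semi3 (semitrilinearC23 hpi)).
- apply: (ultrapower_ext_unique (esym (ureprK (J m))) (heinrich_can hJ b)
    (heinrich_can hJ c)).
  apply/wstar_cvgP => f; rewrite triple_ext_can23.
  apply: extend_ultraclass_cvg (esym (ureprK _)).
  exact: (iter_form_semi3 (semitrilinearC12 (semitrilinearC23
    (semitrilinearC12 hpi)))).
Qed.

(** The net stays in E, where the two extensions agree; there the third
    variable is the middle limit of the extension of index 1, and the
    outermost one is in E. *)
Lemma ultrapower_ext_can_cvg a n p (T : Type) (F : set_system T) (c : T -> E) :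
  Filter F -> wstar_cvg F (fun d => can_bidual (c d)) p ->
  wstar_cvg F
    (fun d => ultrapower_ext pi J (can_bidual a) n (can_bidual (c d)))
    (triple_ext hpi 1 (can_bidual a) n p).
Proof.
move=> FF cp.
rewrite (_ : (fun d => _) =
    fun d => triple_ext hpi 1 (can_bidual a) n (can_bidual (c d))).
  exact: iter_ext_cvg2.
apply/funext => d; apply: ultrapower_ext_two_in_E; right; left.
by split; [exists a|exists (c d)].
Qed.

Section symmetric.
Context (pi_sym : forall a b c, pi a b c = pi c b a).

Lemma ultrapower_extC m n p :
  ultrapower_ext pi J m n p = ultrapower_ext pi J p n m.
Proof.
pose Jr q := esym (ureprK (J q)).
apply: (ultrapower_ext_unique (Jr m) (Jr n) (Jr p)).
rewrite (_ : (fun i => _) = (fun i => can_bidual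
    (pi (urepr (J p) i) (urepr (J n) i) (urepr (J m) i)))).
  exact: (ultrapower_ext_lim (Jr p) (Jr n) (Jr m)).
by apply/funext => i; rewrite pi_sym.
Qed.

(** The order of limits of index 4, read after exchanging the outer variables,
    is that of index 1. *)
Lemma triple_ext4 m n p : triple_ext hpi 4 m n p = triple_ext hpi 1 p n m.
Proof.
apply/val_inj/funext => f /=.
transitivity (iter_form1 false false true (fun c a b => pi a b c) p m n f).
  exact: iter_extE.
rewrite -[RHS]/(iter_ext _ _ _ _ f) iter_extE.
rewrite (_ : (fun c a b => pi a b c) = (fun a c b => pi a b c))//.
by apply/funext => c; apply/funext => a; apply/funext => b.
Qed.
End symmetric.

Lemma wstar_continuous_cvg (V W : normedModType R[i]) (h : dual V -> dual W)
    (T : Type) (F : set_system T) (x : T -> dual V) q :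
  wstar_continuous h -> wstar_cvg F x q -> wstar_cvg F (h \o x) (h q).
Proof. by move=> hc xq; exact: (cvg_comp _ _ xq (hc q)). Qed.

(** First let the third variable run along a net in E: by continuity and by
    [ultrapower_ext_can_cvg] the extensions agree whenever the first variable
    is in E. Both are continuous in the first variable, so they agree
    everywhere. *)
Lemma ultrapower_ext_eq1 :
  (forall n p, wstar_continuous (fun m => ultrapower_ext pi J m n p)) ->
  (forall m n, wstar_continuous (fun p => ultrapower_ext pi J m n p)) ->
  ultrapower_ext pi J = triple_ext hpi 1.
Proof.
move=> c1 c3; apply/funext => m; apply/funext => n; apply/funext => p.
have [A [a [_ am]]] := heinrich_net m; have [C [c [_ cp]]] := heinrich_net p.
have E1 d : ultrapower_ext pi J (can_bidual (a d)) n p =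
    triple_ext hpi 1 (can_bidual (a d)) n p.
  apply: (wstar_cvg_unique _ (wstar_continuous_cvg (c3 _ n) cp)).
  exact: ultrapower_ext_can_cvg.
apply: (wstar_cvg_unique _ (wstar_continuous_cvg (c1 n p) am)).
rewrite (_ : _ \o _ = fun d => triple_ext hpi 1 (can_bidual (a d)) n p).
  exact: iter_ext_cvg1.
by apply/funext => d; exact: E1.
Qed.

End ultrapower_extension.

(** * The proposition *)

Theorem proposition3p10 (R : realType) (E : completeNormedModType R[i])
    (pi : E -> E -> E -> E) (I : Type) (U : ultrafilter_on I)
    (J : bidual E -> ultrapower E U) :
  jordan_triple pi -> heinrich J ->
  [/\ (* (i) *)
      forall m n p : bidual E,
        (range can_bidual m /\ range can_bidual n) \/
        (range can_bidual m /\ range can_bidual p) \/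
        (range can_bidual n /\ range can_bidual p) ->
        forall i : nat, (i <= 5)%N ->
          ultrapower_ext pi J m n p = aron_berner pi i m n p,
      (* (ii) *)
      forall (a : E) (n p : bidual E) (D : directed) (c : D -> E),
        bounded_wnet c p ->
        wstar_cvg (@tails D)
          (fun d => ultrapower_ext pi J (can_bidual a) n (can_bidual (c d)))
          (aron_berner pi 1 (can_bidual a) n p),
      (* (iii) *)
      forall (n m p : bidual E) (A C : directed) (a : A -> E) (c : C -> E),
        bounded_wnet a m -> bounded_wnet c p ->
        (exists2 y : A -> bidual E,
          forall s, wstar_cvg (@tails C)
            (fun t => ultrapower_ext pi J
               (can_bidual (a s)) n (can_bidual (c t))) (y s) &
          wstar_cvg (@tails A) y (aron_berner pi 1 m n p)) /\
        wstar_cvg (@tails A) (fun s => aron_berner pi 1 (can_bidual (a s)) n p)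
          (aron_berner pi 1 m n p) &
      (* (iv) *)
      ((forall n p : bidual E,
          wstar_continuous (fun m => ultrapower_ext pi J m n p)) <->
       (forall m n : bidual E,
          wstar_continuous (fun p => ultrapower_ext pi J m n p))) /\
      ((forall n p : bidual E,
          wstar_continuous (fun m => ultrapower_ext pi J m n p)) ->
        ultrapower_ext pi J = aron_berner pi 1 /\
        aron_berner pi 1 = aron_berner pi 4)].
Proof.
move=> hT hJ; have hpi := triple_semitrilinear hT.
have pi_sym := triple_sym hT.
have piUC m n p := ultrapower_extC hpi hJ pi_sym m n p.
rewrite (aron_bernerE hpi (heinrich_net hJ)).
have c13 : (forall n p : bidual E,
      wstar_continuous (fun m => ultrapower_ext pi J m n p)) <->
    (forall m n : bidual E,
      wstar_continuous (fun p => ultrapower_ext pi J m n p)).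
  split=> cont u v.
    rewrite (_ : (fun p => _) = (fun m => ultrapower_ext pi J m v u)); first exact: cont.
    by apply/funext => p; exact: piUC.
  rewrite (_ : (fun m => _) = (fun p => ultrapower_ext pi J v u p)); first exact: cont.
  by apply/funext => m; exact: piUC.
split.
- by move=> m n p two i _; exact: ultrapower_ext_two_in_E.
- by move=> a n p D c [_ cp]; exact: ultrapower_ext_can_cvg.
- move=> n m p A C a c [_ am] [_ cp].
  have am1 : wstar_cvg (@tails A)
      (fun s => triple_ext hpi 1 (can_bidual (a s)) n p)
      (triple_ext hpi 1 m n p).
    exact: iter_ext_cvg1.
  split=> //; exists (fun s => triple_ext hpi 1 (can_bidual (a s)) n p) => // s.
  exact: ultrapower_ext_can_cvg.
- split=> // c1; have c3 := c13.1 c1.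
  have E1 := ultrapower_ext_eq1 hpi hJ c1 c3; split=> //.
  apply/funext => m; apply/funext => n; apply/funext => p.
  by rewrite (triple_ext4 hpi pi_sym) -E1 piUC.
Qed.
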